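(* Let $G$ be a finite group and $X$ a finite $G$-set. For any morphism $f\colon(A,\mathfrak{a})\to(A',\mathfrak{a}')$ in $\mathbb{B}(\frac{X}{G})={}_G\mathrm{set}/X$, the following are equivalent. (1) $f$ is an isomorphism in ${}_G\mathrm{set}/X$. (2) $f|_{\mathfrak{a}^{-1}(x)}\colon\mathfrak{a}^{-1}(x)\to\mathfrak{a}'^{-1}(x)$ is an isomorphism in $\mathbb{B}(\frac{\mathbf{1}}{e})=\mathrm{set}$ (i.e. a bijection of sets) for any $x\in X$. (3) $f|_{\mathfrak{a}^{-1}(X_0)}\colon\mathfrak{a}^{-1}(X_0)\to\mathfrak{a}'^{-1}(X_0)$ is an isomorphism for any $G$-orbit $X_0\subseteq X$.
   Context: For a finite group $G$, ${}_G\mathrm{set}$ is the category of finite $G$-sets and $G$-equivariant maps. The pair of a finite group $G$ and a finite $G$-set $X$ is denoted $\frac{X}{G}$, and $\mathbb{B}(\frac{X}{G})={}_G\mathrm{set}/X$ is the slice category: objects $(A,\mathfrak{a})$ are $G$-maps $\mathfrak{a}\colon A\to X$ with $A$ a finite $G$-set, and morphisms $(A,\mathfrak{a})\to(A',\mathfrak{a}')$ are $G$-maps $f\colon A\to A'$ with $\mathfrak{a}'\circ f=\mathfrak{a}$. Here $\mathbf{1}$ is the one-point set, $e$ is the trivial group, and $\mathrm{set}$ is the category of finite sets, identified with ${}_e\mathrm{set}/\mathbf{1}$. For a $G$-orbit $X_0$, the sets $\mathfrak{a}^{-1}(X_0)$ and $\mathfrak{a}'^{-1}(X_0)$ are $G$-sets,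 and isomorphism in (3) is in the category of $G$-sets (over $X_0$). *)

(* Defs.v *)
From mathcomp Require Import all_boot all_fingroup.

Set Implicit Arguments.
Unset Strict Implicit.
Unset Printing Implicit Defensive.

(* MathComp actions are right actions: a left G-set is encoded by             *)
(* x * g := g^-1 . x. Equivariant maps, G-stable subsets and orbits are the   *)
(* same for both conventions.                                                 *)
Record gset (G : finGroupType) := GSet {
  gset_carrier :> finType;
  gset_act : {action G &-> gset_carrier}
}.

Record gmap (G : finGroupType) (A B : gset G) := GMap {
  gmap_fun :> A -> B;
  gmap_equiv : morph_act (gset_act A) (gset_act B) gmap_fun id
}.

(* Objects of the slice category of finite G-sets over X. *)
Record gset_over (G : finGroupType) (X : gset G) := GSetOver {
  over_gset :> gset G;
  over_map : gmap over_gset X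
}.

Record over_hom (G : finGroupType) (X : gset G) (A B : gset_over X) := OverHom {
  over_hom_gmap :> gmap A B;
  over_hom_comm : over_map B \o over_hom_gmap =1 over_map A
}.

(* Morphisms are compared through their underlying maps, so "cancel f h" says *)
(* that the composite of f followed by h is the identity morphism.            *)
Definition over_iso (G : finGroupType) (X : gset G) (A B : gset_over X)
    (f : over_hom A B) : Prop :=
  exists h : over_hom B A, cancel f h /\ cancel h f.

Definition gstable (G : finGroupType) (X : gset G) (S : {set X}) : bool :=
  [acts [set: G], on S | gset_act X].

Definition is_orbit (G : finGroupType) (X : gset G) (S : {set X}) : Prop :=
  exists x : X, S = orbit (gset_act X) [set: G] x.

Lemma orbit_gstable (G : finGroupType) (X : gset G) (S : {set X}) :
  is_orbit S -> gstable S.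
Proof. by case=> x ->; apply: acts_orbit; apply: subsetT. Qed.

Definition restrict (T T' : finType) (S : {set T}) (S' : {set T'}) (f : T -> T')
    (fS : forall y, y \in S -> f y \in S') (u : {y : T | y \in S}) :
    {y : T' | y \in S'} :=
  exist _ (f (val u)) (fS (val u) (valP u)).

Section SubGSet.
Variables (G : finGroupType) (X : gset G) (S : {set X}) (stS : gstable S).

Lemma gstable_act (g : G) (x : X) : x \in S -> gset_act X x g \in S.
Proof. by move=> Sx; rewrite (acts_act stS) ?inE. Qed.

Definition sub_act (u : {x : X | x \in S}) (g : G) : {x : X | x \in S} :=
  restrict (gstable_act g) u.

Lemma sub_act1 : sub_act^~ 1%g =1 id.
Proof. by move=> u; apply: val_inj; rewrite /= act1. Qed.

Lemma sub_actM (u : {x : X | x \in S}) : act_morph sub_act u.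
Proof. by move=> g h; apply: val_inj; rewrite /= actM. Qed.

Definition sub_gset : gset G :=
  @GSet G {x : X | x \in S} (TotalAction sub_act1 sub_actM).

End SubGSet.

Section Restriction.
Variables (G : finGroupType) (X : gset G).

Lemma preim_gstable (A : gset_over X) (S : {set X}) :
  gstable S -> gstable (over_map A @^-1: S).
Proof.
move=> stS; apply/actsP=> g Gg y.
by rewrite !inE gmap_equiv (acts_act stS).
Qed.

Lemma over_map_preim (A : gset_over X) (S : {set X}) (y : A) :
  y \in over_map A @^-1: S -> over_map A y \in S.
Proof. by rewrite inE. Qed.

Lemma over_hom_preim (A B : gset_over X) (f : over_hom A B) (S : {set X})
  (y : A) : y \in over_map A @^-1: S -> f y \in over_map B @^-1: S.
Proof. by rewrite !inE -(over_hom_comm f y). Qed.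

Definition restrict_fun (A B : gset_over X) (f : over_hom A B) (S : {set X}) :
    {y : A | y \in over_map A @^-1: S} -> {y : B | y \in over_map B @^-1: S} :=
  restrict (@over_hom_preim A B f S).

Arguments restrict_fun {A B} f S u.

Variables (S : {set X}) (stS : gstable S).

Lemma restrict_map_equiv (A : gset_over X) :
  morph_act (gset_act (sub_gset (preim_gstable A stS)))
    (gset_act (sub_gset stS)) (restrict (@over_map_preim A S)) id.
Proof. by move=> u g; apply: val_inj; apply: gmap_equiv. Qed.

Definition restrict_over (A : gset_over X) : gset_over (sub_gset stS) :=
  GSetOver (GMap (@restrict_map_equiv A)).

Lemma restrict_hom_equiv (A B : gset_over X) (f : over_hom A B) :
  morph_act (gset_act (restrict_over A)) (gset_act (restrict_over B))
    (restrict_fun f S) id.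
Proof. by move=> u g; apply: val_inj; apply: gmap_equiv. Qed.

Lemma restrict_hom_comm (A B : gset_over X) (f : over_hom A B) :
  over_map (restrict_over B) \o GMap (restrict_hom_equiv f)
    =1 over_map (restrict_over A).
Proof. by move=> u; apply: val_inj; apply: (over_hom_comm f). Qed.

Definition restrict_hom (A B : gset_over X) (f : over_hom A B) :
    over_hom (restrict_over A) (restrict_over B) :=
  OverHom (restrict_hom_comm f).

End Restriction.

Arguments restrict_fun {G X A B} f S u.

(* Main.v *)
Require Import Defs.
From mathcomp Require Import all_boot all_fingroup.

(** All three conditions say that the underlying map of [f] is bijective.
    An isomorphism of the slice category is the same as a morphism with a
    bijective underlying map, because a set-theoretic inverse automatically
    commutes with the actions and with the structure maps ([over_isoP]).
    Moreover [f] preserves the structure maps, so it maps the part of [A] lying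
    over a subset [S] of [X] into the part of [A'] lying over [S], and no other
    element of [A] goes there.  Bijectivity of [f] can therefore be tested on
    any family of subsets that covers [X] ([bij_restrict_fun] and
    [bij_of_cover]): the singletons give condition (2), the orbits
    condition (3). *)

Lemma over_isoP (G : finGroupType) (X : gset G) (A B : gset_over X)
    (f : over_hom A B) : over_iso f <-> bijective f.
Proof.
split=> [[h [fK hK]] | [h fK hK]]; first by exists h.
have h_equiv : morph_act (gset_act B) (gset_act A) h id.
  by move=> z g; apply: (can_inj fK); rewrite gmap_equiv !hK.
have h_comm : over_map A \o GMap h_equiv =1 over_map B.
  by move=> z; rewrite /= -(over_hom_comm f) /= hK.
by exists (OverHom h_comm).
Qed.

(** The inverse of [f] preserves the structure maps as well, hence it restricts
    to the parts lying over [S]. *)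
Lemma bij_restrict_fun (G : finGroupType) (X : gset G) (A B : gset_over X)
    (f : over_hom A B) (S : {set X}) :
  bijective f -> bijective (restrict_fun f S).
Proof.
case=> h fK hK.
have hS z : z \in over_map B @^-1: S -> h z \in over_map A @^-1: S.
  by rewrite !inE -(over_hom_comm f) /= hK.
by exists (restrict hS) => u; apply: val_inj; [apply: fK | apply: hK].
Qed.

(** Two elements with the same image under [f] lie over the same point of [X],
    so both injectivity and surjectivity of [f] can be checked over a single
    member of the cover. *)
Lemma bij_of_cover (G : finGroupType) (X : gset G) (A B : gset_over X)
    (f : over_hom A B) :
  (forall x : X, exists2 S : {set X},
     x \in S & bijective (restrict_fun f S)) -> bijective f.
Proof.
move=> cover.
have f_inj : injective f.
  move=> y z eq_f; have [S Sx bijS] := cover (over_map A y).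
  have Sy : y \in over_map A @^-1: S by rewrite inE.
  have Sz : z \in over_map A @^-1: S.
    by rewrite inE -(over_hom_comm f z) /= -eq_f [over_map B _](over_hom_comm f y).
  have eq_res : restrict_fun f S (exist _ y Sy) = restrict_fun f S (exist _ z Sz).
    exact: val_inj.
  by have /(congr1 val) := bij_inj bijS eq_res.
have f_surj (z : B) : exists y : A, f y = z.
  have [S Sx [h _ hK]] := cover (over_map B z).
  have Sz : z \in over_map B @^-1: S by rewrite inE.
  exists (val (h (exist _ z Sz))).
  by have /(congr1 val) := hK (exist _ z Sz).
have [h hK] := fin_all_exists f_surj.
by exists h => //; apply: inj_can_sym.
Qed.

Theorem proposition6p2 (G : finGroupType) (X : gset G) (A A' : gset_over X)
    (f : over_hom A A') :
  [<-> over_iso f;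
       forall x : X, bijective (restrict_fun f [set x]);
       forall (X0 : {set X}) (orbX0 : is_orbit X0),
         over_iso (restrict_hom (orbit_gstable orbX0) f)].
Proof.
tfae.
- by move=> /over_isoP bij_f x; apply: bij_restrict_fun.
- move=> bij_fibre X0 orbX0; apply/over_isoP/bij_restrict_fun/bij_of_cover => x.
  by exists [set x]; [apply: set11 | apply: bij_fibre].
- move=> iso_orb; apply/over_isoP/bij_of_cover => x.
  have orb_x : is_orbit (orbit (gset_act X) [set: G] x) by exists x.
  exists (orbit (gset_act X) [set: G] x); first exact: orbit_refl.
  exact: (proj1 (over_isoP _ _ _ _ _) (iso_orb _ orb_x)).
Qed.
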